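(* Let $H:\mathbb{R}^{2d}\to\mathbb{R}$ be continuous with $H(q,-p)=H(q,p)$ and $\int e^{-H}=1$. For $0<h<h_0$ let $\Psi_h$ be a continuous, Lebesgue-measure-preserving bijection of $\mathbb{R}^{2d}$ reversible with respect to $S(q,p)=(q,-p)$, and let $\Delta(x;h)=H(\Psi_h(x))-H(x)$. Define $\mu(h)=\int\Delta(x;h)e^{-H(x)}dx$, $s^2(h)=\int\Delta(x;h)^2e^{-H(x)}dx$, $\sigma^2(h)=s^2(h)-\mu(h)^2$. Let $\nu$ be a positive integer and assume: (i) there are functions $a(x)$ and $r(x;h)$ with $\Delta(x;h)=h^\nu a(x)+h^\nu r(x;h)$ and $\lim_{h\to0}r(x;h)=0$ for each $x$; (ii) there is a function $D\ge0$ with $\int De^{-H}<\infty$ and $\sup_{0<h<h_0}\Delta(x;h)^2/h^{2\nu}\le D(x)$ for all $x$. Then $$\lim_{h\to0}\frac{\mu(h)}{h^{2\nu}}=\frac\Sigma2,\qquad\lim_{h\to0}\frac{\sigma^2(h)}{h^{2\nu}}=\Sigma,\qquad \Sigma=\int_{\mathbb{R}^{2d}}a(x)^2e^{-H(x)}dx.$$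
   Context: In the application, $\Psi_h$ is the map advancing Hamilton's equations for $H$ over a fixed time interval $[0,\lambda]$ ($\lambda/h$ an integer) with a reversible volume-preserving integrator of order $\nu$. *)

(* Defs.v *)
From HB Require Import structures.
From mathcomp Require Import all_boot all_order all_algebra.
From mathcomp Require Import all_classical all_reals all_analysis.
Set Implicit Arguments. Unset Strict Implicit. Unset Printing Implicit Defensive.
Import Order.TTheory GRing.Theory Num.Theory.
Import numFieldNormedType.Exports.
Local Open Scope classical_set_scope.
Local Open Scope ring_scope.

(* Product (Borel) sigma-algebra on row vectors 'rV[R]_n = R^n:
   generated by the coordinate projections (as for n.-tuples in the library). *)
Definition rV_display : measure_display -> measure_display.
Proof. exact. Qed.

Section measurable_rV.
Context (R : realType) (n : nat).

Definition rV_coord : 'I_n -> 'rV[R]_n -> measurableTypeR R :=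
  fun i x => x ord0 i.

Let rV_set0 : g_sigma_preimage rV_coord set0.
Proof. exact: sigma_algebra0. Qed.

Let rV_setC A : g_sigma_preimage rV_coord A -> g_sigma_preimage rV_coord (~` A).
Proof. exact: sigma_algebraC. Qed.

Let rV_bigcup (F : _^nat) : (forall i, g_sigma_preimage rV_coord (F i)) ->
  g_sigma_preimage rV_coord (\bigcup_i (F i)).
Proof. exact: sigma_algebra_bigcup. Qed.

HB.instance Definition _ := @isMeasurable.Build (rV_display default_measure_display)
  'rV[R]_n (g_sigma_preimage rV_coord) rV_set0 rV_setC rV_bigcup.

End measurable_rV.

Fixpoint lebesgue_tuple (R : realType) (n : nat) :
    set (n.-tuple (measurableTypeR R)) -> \bar R :=
  match n with
  | 0 => fun A => (\d_([tuple] : 0.-tuple (measurableTypeR R)) A)%E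
  | m.+1 => pushforward ((@lebesgue_measure R) \x (@lebesgue_tuple R m))%E
              (fun p : measurableTypeR R * m.-tuple (measurableTypeR R) =>
                 [tuple of p.1 :: p.2])
  end.

Definition lebesgue_rV (R : realType) (n : nat) : set 'rV[R]_n -> \bar R :=
  pushforward (@lebesgue_tuple R n)
    (fun t : n.-tuple (measurableTypeR R) => \row_(i < n) (tnth t i : R)).

Definition flip (R : realType) (d : nat) (x : 'rV[R]_(d + d)) : 'rV[R]_(d + d) :=
  row_mx (lsubmx x) (- rsubmx x).

Definition energy_error (R : realType) (n : nat) (H : 'rV[R]_n -> R)
  (Psi : R -> 'rV[R]_n -> 'rV[R]_n) (h : R) (x : 'rV[R]_n) : R :=
  H (Psi h x) - H x.

Definition mean_err (R : realType) (n : nat) (H : 'rV[R]_n -> R)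
  (Psi : R -> 'rV[R]_n -> 'rV[R]_n) (h : R) : R :=
  fine (\int[@lebesgue_rV R n]_x (energy_error H Psi h x * expR (- H x))%:E)%E.

Definition second_moment_err (R : realType) (n : nat) (H : 'rV[R]_n -> R)
  (Psi : R -> 'rV[R]_n -> 'rV[R]_n) (h : R) : R :=
  fine (\int[@lebesgue_rV R n]_x
          (energy_error H Psi h x ^+ 2 * expR (- H x))%:E)%E.

Definition var_err (R : realType) (n : nat) (H : 'rV[R]_n -> R)
  (Psi : R -> 'rV[R]_n -> 'rV[R]_n) (h : R) : R :=
  second_moment_err H Psi h - mean_err H Psi h ^+ 2.

(* Main.v *)
(** By reversibility, [phi = flip \o Psi h] is a measure-preserving involution
    with [Delta (phi x) = - Delta x] and [H (phi x) = H x + Delta x].  Hence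
    [2 Delta / (e^Delta + 1) * e^(- H)] is odd under [phi] and integrates to 0,
    and subtracting it from the mean gives
    [mu(h) = \int Delta tanh(Delta / 2) e^(- H)].
    Since [|tanh (t / 2)| <= |t|] and [tanh (t / 2) ~ t / 2], dominated
    convergence applies to this form of the mean with the same dominating
    function [D e^(- H)] as for the second moment. *)
Require Import Defs.
From HB Require Import structures.
From mathcomp Require Import all_boot all_order all_algebra.
From mathcomp Require Import all_classical all_reals all_analysis.
From mathcomp Require Import measurable_realfun ring lra.
Import Order.TTheory GRing.Theory Num.Theory.
Import numFieldNormedType.Exports.
Local Open Scope classical_set_scope.
Local Open Scope ring_scope.

(** * Lebesgue measure on tuples: sigma-finiteness and sign changes *)

Section tuple_cons.
Context {R : realType} {n : nat}.
Local Notation T := (measurableTypeR R).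

Definition cons_pair (p : T * n.-tuple T) : n.+1.-tuple T :=
  [tuple of p.1 :: p.2].

Lemma measurable_cons_pair : measurable_fun setT cons_pair.
Proof. exact: measurable_cons. Qed.

Lemma measurable_uncons :
  measurable_fun setT (fun t : n.+1.-tuple T => (thead t, [tuple of behead t])).
Proof.
apply: measurable_fun_pair; first exact: measurable_tnth.
apply/measurable_fun_tnthP => i.
rewrite (_ : _ \o _ = (@tnth _ T)^~ (lift ord0 i)).
  exact: measurable_tnth.
apply/funext => t /=; rewrite tnth_behead; congr tnth; apply: val_inj.
by rewrite /= inordK// ltnS.
Qed.

End tuple_cons.


Section lebesgue_cons.
Context {R : realType} {n : nat}.
Local Notation T := (measurableTypeR R).
Variable mu : {sigma_finite_measure set (n.-tuple T) -> \bar R}.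

(** The successor step of [lebesgue_tuple], over a bundled [mu], so that the measure and
    sigma-finiteness structures can be attached to it. *)
Definition lebesgue_cons : set (n.+1.-tuple T) -> \bar R :=
  pushforward (@lebesgue_measure R \x mu)%E cons_pair.

HB.instance Definition _ := Measure.copy lebesgue_cons
  (measure_function_pushforward__canonical__measure_function_Measure
    (@lebesgue_measure R \x mu)%E (@measurable_cons_pair R n)).

Lemma lebesgue_cons_sigma_finite : sigma_finite setT lebesgue_cons.
Proof.
have /sigma_finiteP[F [FT ndF Foo]] := sigma_finiteT (@lebesgue_measure R).
have /sigma_finiteP[G [GT ndG Goo]] := sigma_finiteT mu.
pose u (t : n.+1.-tuple T) := (thead t, [tuple of behead t]).
have uK B : cons_pair @^-1` (u @^-1` B) = B.
  apply/funext => -[x t]; rewrite /preimage /= /u; congr (B (_, _)).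
  exact: val_inj.
(* Both exhaustions are nondecreasing, so a pair in [F k] and [G l] lies in the rectangle of index
   [maxn k l]. *)
exists (fun k => u @^-1` (F k `*` G k)).
  rewrite -preimage_bigcup (_ : \bigcup_k _ = setT) ?preimage_setT//.
  apply/seteqP; split=> // -[x t] _.
  have [k _ Fkx] : (\bigcup_k F k) x by rewrite -FT.
  have [l _ Glt] : (\bigcup_k G k) t by rewrite -GT.
  exists (maxn k l) => //; split=> /=.
  - by move: x Fkx; exact/subsetPset/ndF/leq_maxl.
  - by move: t Glt; exact/subsetPset/ndG/leq_maxr.
move=> k; have [mF Fk] := Foo k; have [mG Gk] := Goo k; split.
  rewrite -[X in measurable X]setTI; apply: measurable_uncons => //.
  exact: measurableX.
rewrite /lebesgue_cons /pushforward uK product_measure1E//.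
by rewrite lte_mul_pinfty// ge0_fin_numE.
Qed.

HB.instance Definition _ := Measure_isSigmaFinite.Build _ _ _
  lebesgue_cons lebesgue_cons_sigma_finite.

End lebesgue_cons.

(** [lebesgue_tuple] is a bare set function; this equation allows replacing it by a bundled measure
    wherever Fubini-type lemmas are applied. *)
Lemma lebesgue_tuple_sigma_finite_measure (R : realType) n :
  exists mu :
    {sigma_finite_measure set (n.-tuple (measurableTypeR R)) -> \bar R},
    @lebesgue_tuple R n = mu.
Proof.
elim: n => [|n [mu muE]].
  by exists (\d_ ([tuple] : 0.-tuple (measurableTypeR R))).
by exists (lebesgue_cons mu); rewrite /= muE.
Qed.

(** The sign pattern is indexed by all of [nat], so that in an induction on the length the tail
    simply uses the shifted pattern. *)
Definition negate_tuple {R : realType} (e : nat -> bool) {n}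
    (t : n.-tuple (measurableTypeR R)) : n.-tuple (measurableTypeR R) :=
  [tuple (-1) ^+ e i * tnth t i | i < n].

Lemma lebesgue_measure_sign (R : realType) (b : bool)
    (A : set (measurableTypeR R)) :
  measurable A ->
  lebesgue_measure
    ((fun x : measurableTypeR R => (-1) ^+ b * x : measurableTypeR R) @^-1` A) =
  lebesgue_measure A.
Proof.
move=> mA; case: b.
  by under eq_fun do rewrite expr1 mulN1r; exact: lebesgue_measureN.
by under eq_fun do rewrite expr0 mul1r.
Qed.

Lemma measurable_negate_tuple (R : realType) e n :
  measurable_fun setT (@negate_tuple R e n).
Proof.
apply/measurable_fun_tnthP => i.
rewrite (_ : _ \o _ = fun t => (-1) ^+ e i * tnth t i); last first.
  by apply/funext => t /=; rewrite tnth_mktuple.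
apply: measurable_funM => //.
exact: measurable_tnth.
Qed.

(** Induction on [n], with the product measure written as an integral of measures of sections: the
    induction hypothesis removes the signs of the tail in each section, and the substitution [g]
    removes the sign of the head in the outer integral. *)
Lemma lebesgue_tuple_negate (R : realType) e n A : measurable A ->
  @lebesgue_tuple R n (negate_tuple e @^-1` A) = lebesgue_tuple A.
Proof.
elim: n e A => [|n IH] e A mA.
  congr (lebesgue_tuple _); apply/funext => t /=.
  by rewrite (tuple0 (negate_tuple e t)) [t]tuple0.
have [mu muE] := lebesgue_tuple_sigma_finite_measure R n.
rewrite /= muE /pushforward /product_measure1 /=.
set C := cons_pair @^-1` A.
have mC : measurable C by rewrite -[C]setTI; exact: measurable_cons_pair.
pose g (x : measurableTypeR R) : measurableTypeR R := (-1) ^+ e 0%N * x.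
transitivity (\int[lebesgue_measure]_x ((mu \o xsection C) \o g) x)%E.
  apply: eq_integral => x _ /=.
  rewrite -muE -[RHS](IH (fun i => e i.+1)); last exact: measurable_xsection.
  congr lebesgue_tuple; apply/funext => t; rewrite !xsectionE /C /preimage/=.
  congr A; apply: eq_from_tnth => i.
  rewrite /cons_pair /negate_tuple tnth_mktuple.
  by have [j ->|->] := unliftP ord0 i; rewrite ?tnthS ?tnth0 ?tnth_mktuple.
have mg : measurable_fun setT g by exact: measurable_funM.
have mm : measurable_fun setT (mu \o xsection C).
  exact: measurable_fun_xsection.
transitivity (\int[pushforward lebesgue_measure g]_x (mu \o xsection C) x)%E.
  by rewrite (ge0_integral_pushforward mg)// preimage_setT.
apply: eq_measure_integral => B mB _.
exact: lebesgue_measure_sign.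
Qed.

(** * Borel measurability on row vectors *)

Lemma measurable_rV_coord (R : realType) n (i : 'I_n) :
  measurable_fun setT (@rV_coord R n i).
Proof.
move=> _ Y mY; rewrite setTI; apply: sub_sigma_algebra => /=.
rewrite -bigcup_seq/=; exists i => /=; first by rewrite mem_index_enum.
by exists Y => //; rewrite setTI.
Qed.

Lemma measurable_fun_rV d (T : measurableType d) (R : realType) n
    (f : T -> 'rV[R]_n) :
  (forall i, measurable_fun setT (fun x => f x ord0 i : measurableTypeR R)) ->
  measurable_fun setT f.
Proof.
move=> mf; apply: (measurability (\big[setU/set0]_(i < n)
  preimage_set_system setT (@rV_coord R n i) measurable)) => //.
move=> _ [B + <-]; rewrite -bigcup_seq => -[i _ [Y mY <-]].
by rewrite setTI; exact: mf.
Qed.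

Lemma measurable_row (R : realType) n : measurable_fun setT
  (fun t : n.-tuple (measurableTypeR R) => \row_(i < n) (tnth t i : R)).
Proof.
apply: measurable_fun_rV => i; under eq_fun do rewrite mxE.
exact: measurable_tnth.
Qed.

(** Links the topology to the sigma-algebra generated by coordinates: an open set is the union of
    the countably many boxes with rational centre and radius [1 / (k + 1)] that it contains. *)
Lemma open_rV_measurable (R : realType) n (U : set 'rV[R]_n) :
  open U -> measurable U.
Proof.
move=> oU.
pose box (q : 'rV[rat]_n * nat) : set 'rV[R]_n :=
  \bigcap_(i in [set: 'I_n])
    rV_coord i @^-1` ball (ratr (q.1 ord0 i) : R) q.2.+1%:R^-1.
have mbox q : measurable (box q).
  apply: fin_bigcap_measurable => // i _.
  rewrite -[X in measurable X]setTI; apply: measurable_rV_coord => //.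
  exact: measurable_ball.
pose F q := if `[< box q `<=` U >] then box q else set0.
suff -> : U = \bigcup_q F q.
  apply: countable_bigcupT_measurable => // q; rewrite /F.
  by case: ifPn.
apply/seteqP; split=> [x Ux|x [q _]]; last first.
  by rewrite /F; case: ifPn => // /asboolP; exact.
have /nbhs_ballP[e/= e0 xeU] : nbhs x U by exact: open_nbhs_nbhs.
(* Radius below [e / 2]: going from [x] to the centre and on to a point of the box stays within
   [e]. *)
have [k ke] : exists k : nat, k.+1%:R^-1 < e / 2.
  exact: filter_ex (near_infty_natSinv_lt (PosNum (divr_gt0 e0 (ltr0n _ 2)))).
have /choice[c xc] : forall i, exists c : rat, `|x ord0 i - ratr c| < k.+1%:R^-1.
  move=> i.
  have /rat_in_itvoo[c] : x ord0 i < x ord0 i + k.+1%:R^-1 by rewrite ltrDl.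
  rewrite in_itv/= => /andP[xc cx]; exists c.
  by rewrite distrC gtr0_norm ?subr_gt0// ltrBlDl.
exists (\row_i c i, k) => //.
have xbox : box (\row_i c i, k) x.
  by move=> i _; rewrite /= /preimage/ball/rV_coord/= mxE distrC.
rewrite /F ifT//; apply/asboolP => y boxy; apply: xeU.
split=> // j i; rewrite (ord1 j) /ball/=.
rewrite (splitr e) (le_lt_trans (ler_distD (ratr (c i)) _ _))// ltrD//.
  exact: lt_trans (xc i) ke.
have := boxy i I; rewrite /= /preimage/ball/rV_coord/= mxE => /lt_trans; exact.
Qed.

Lemma continuous_measurable_rV (R : realType) n (f : 'rV[R]_n -> R) :
  continuous f -> measurable_fun setT f.
Proof.
move=> /continuousP cf; apply: (measurability _ (RGenOpens.measurableE R)).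
move=> _ [_ [a [b ->] <-]]; rewrite setTI; apply: open_rV_measurable.
exact/cf/interval_open.
Qed.

Lemma continuous_measurable_rV_rV (R : realType) m n
    (f : 'rV[R]_m -> 'rV[R]_n) :
  continuous f -> measurable_fun setT f.
Proof.
move=> cf; apply: measurable_fun_rV => i; apply: continuous_measurable_rV => x.
apply: (@continuous_comp _ _ _ f (fun y : 'rV[R]_n => y ord0 i)).
  exact: cf.
exact: coord_continuous.
Qed.

(** * Lebesgue measure on row vectors and its invariance under [flip] *)

Lemma lebesgue_rV_measure (R : realType) n :
  exists mu : {measure set 'rV[R]_n -> \bar R}, @lebesgue_rV R n = mu.
Proof.
have [mu muE] := lebesgue_tuple_sigma_finite_measure R n.
exists (measure_function_pushforward__canonical__measure_function_Measure
  mu (@measurable_row R n)).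
by rewrite /lebesgue_rV muE.
Qed.

Lemma measurable_flip (R : realType) d : measurable_fun setT (@flip R d).
Proof.
apply: measurable_fun_rV => i; case: (split_ordP i) => j ->.
  by under eq_fun do rewrite row_mxEl mxE; exact: measurable_rV_coord.
under eq_fun do rewrite row_mxEr !mxE.
by apply: measurable_funN; exact: measurable_rV_coord.
Qed.

Lemma lebesgue_rV_flip (R : realType) d (A : set 'rV[R]_(d + d)) :
  measurable A -> lebesgue_rV (@flip R d @^-1` A) = lebesgue_rV A.
Proof.
move=> mA; rewrite /lebesgue_rV /pushforward.
have mrA := @measurable_row R (d + d) measurableT A mA.
rewrite setTI in mrA.
(* On tuples, [flip] is the sign change of the coordinates of index at least [d]. *)
rewrite -[RHS](lebesgue_tuple_negate R (fun i => d <= i)%N)//.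
congr lebesgue_tuple; apply/funext => t; congr A.
apply/rowP => i; rewrite [RHS]mxE /negate_tuple tnth_mktuple.
case: (split_ordP i) => j ->.
  by rewrite row_mxEl !mxE/= leqNgt ltn_ord/= mul1r.
by rewrite row_mxEr !mxE/= leq_addr mulN1r.
Qed.

(** * Integrability criteria and dominated convergence for a real parameter *)

Lemma le_integrable_EFin d (T : measurableType d) (R : realType)
    (mu : {measure set T -> \bar R}) (f g : T -> R) :
  measurable_fun setT f -> (forall x, `|f x| <= g x) ->
  mu.-integrable setT (EFin \o g) -> mu.-integrable setT (EFin \o f).
Proof.
move=> mf fg; apply: le_integrable => //; first exact/measurable_EFinP.
by move=> x _ /=; rewrite lee_fin (le_trans (fg x)) ?ler_norm.
Qed.

Lemma ge0_integrable_EFin d (T : measurableType d) (R : realType)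
    (mu : {measure set T -> \bar R}) (f : T -> R) :
  measurable_fun setT f -> (forall x, 0 <= f x) ->
  (\int[mu]_x (f x)%:E < +oo)%E -> mu.-integrable setT (EFin \o f).
Proof.
move=> mf f0 foo; apply/integrableP; split; first exact/measurable_EFinP.
by under eq_integral => x _ do rewrite /= ger0_norm//.
Qed.

(** Right limits are tested on positive sequences tending to 0, and dominated convergence is applied
    along each of them. *)
Lemma dominated_at_right d (T : measurableType d) (R : realType)
    (mu : {measure set T -> \bar R}) (h0 : R) (F : R -> T -> R) (f g : T -> R) :
  0 < h0 ->
  (forall h, 0 < h < h0 -> measurable_fun setT (F h)) ->
  (forall x, F h x @[h --> 0^'+] --> f x) ->
  mu.-integrable setT (EFin \o g) ->
  (forall h x, 0 < h < h0 -> `|F h x| <= g x) ->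
  mu.-integrable setT (EFin \o f) /\
  \int[mu]_x F h x @[h --> 0^'+] --> \int[mu]_x f x.
Proof.
move=> h0_gt0 mF Ff ig Fg.
have H (u : R^nat) : (forall n, 0 < u n < h0) -> u n @[n --> \oo] --> 0 ->
    mu.-integrable setT (EFin \o f) /\
    \int[mu]_x F (u n) x @[n --> \oo] --> \int[mu]_x f x.
  move=> uh u0.
  have Fuf x : F (u n) x @[n --> \oo] --> f x.
    move: (Ff x) => /cvg_at_rightP; apply; split => // n.
    by case/andP: (uh n).
  have mFu n : measurable_fun setT (F (u n)) by exact: mF.
  have mf : measurable_fun setT f.
    by apply: (@measurable_fun_cvg _ _ _ _ (fun n => F (u n))).
  have [|||||/= intf _ cvgf] := @dominated_convergence _ _ _ mu setT measurableT
    (fun n => EFin \o F (u n)) (EFin \o f) (EFin \o g).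
  - by move=> n; exact/measurable_EFinP.
  - exact/measurable_EFinP.
  - by apply: aeW => x _; apply: cvg_EFin; [exact: nearW|exact: Fuf].
  - exact: ig.
  - by apply: aeW => x n _; rewrite lee_fin; exact: Fg.
  split=> //; apply: fine_cvg; rewrite fineK//.
  exact: integral_fune_fin_num.
split.
  (* Integrability of the limit needs just one sequence inside the interval from 0 to [h0]. *)
  apply: (H (fun n => h0 / 2 * harmonic n) _ _).1 => [n|].
    rewrite mulr_gt0 ?divr_gt0 ?harmonic_gt0//=.
    apply: (@le_lt_trans _ _ (h0 / 2)); last by lra.
    have h1 : harmonic n <= 1 :> R by rewrite /= invf_le1 ?ler1n.
    by rewrite ler_piMr// divr_ge0 ?ltW.
  rewrite -(mulr0 (h0 / 2)); apply: cvgMr; exact: cvg_harmonic.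
apply/cvg_at_rightP => u [u_gt0 u0].
have [N _ Nu] : \forall n \near \oo, u n < h0 by exact: (cvgr_lt _ u0).
(* A general sequence is below [h0] only from rank [N] on, hence the shift. *)
rewrite -(cvg_shiftn N).
apply: (H (fun n => u (n + N)%N) _ _).2 => [n|].
  by rewrite u_gt0 Nu//= leq_addl.
by rewrite (cvg_shiftn N u).
Qed.

(** * Estimates for tanh(t / 2) and its second-order limit *)

(* tanh (t / 2). *)
Definition half_tanh {R : realType} (t : R) : R := (expR t - 1) / (expR t + 1).

(** Follows from [1 + t <= expR t] and the same inequality at [- t], which reads
    [expR t * (1 - t) <= 1]. *)
Lemma normr_half_tanh (R : realType) (t : R) :
  `|half_tanh t| <= `|t|.
Proof.
have Y0 := expR_gt0 t; have Y1 := expR_ge1Dx t.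
have Y2 : expR t * (1 - t) <= 1.
  by rewrite -ler_pdivlMl// -expRN mulr1 expR_ge1Dx.
have Y3 : 0 < expR t + 1 by rewrite addr_gt0.
rewrite /half_tanh normrM normfV (gtr0_norm Y3) ler_pdivrMr//.
have [t0|t0] := leP 0 t.
  rewrite (ger0_norm t0) ler_norml; apply/andP; split; nra.
rewrite (ltr0_norm t0) ler_norml; apply/andP; split; nra.
Qed.

(** The upper bound comes from [expR t * (1 - t) <= 1] and [(1 + t + 2 * t ^+ 2) * (1 - t) = 1 + t
    ^+ 2 * (1 - 2 * t)], which is at least 1 when [t <= 1 / 2]. *)
Lemma expR_second_order (R : realType) (t : R) : t <= 1 / 2 ->
  0 <= expR t - 1 - t <= 2 * t ^+ 2.
Proof.
move=> t2; have Y0 := expR_gt0 t; have Y1 := expR_ge1Dx t.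
have Y2 : expR t * (1 - t) <= 1.
  by rewrite -ler_pdivlMl// -expRN mulr1 expR_ge1Dx.
apply/andP; split; first lra.
have : expR t * (1 - t) <= (1 + t + 2 * t ^+ 2) * (1 - t) by nra.
rewrite ler_pM2r; lra.
Qed.

Lemma continuous_logistic (R : realType) :
  continuous (fun t : R => (expR t + 1)^-1).
Proof.
move=> t; apply: cvgV; first by rewrite gt_eqF// addr_gt0// expR_gt0.
by apply: cvgD; [exact: continuous_expR|exact: cvg_cst].
Qed.

Lemma measurable_half_tanh (R : realType) :
  measurable_fun setT (@half_tanh R).
Proof.
apply: continuous_measurable_fun => t; apply: cvgM.
  by apply: cvgB; [exact: continuous_expR|exact: cvg_cst].
exact: continuous_logistic.
Qed.

Lemma eq_cvg_at_right (R : realType) (f g : R -> R) (x0 e l : R) : x0 < e ->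
  (forall h, x0 < h < e -> f h = g h) ->
  f h @[h --> x0^'+] --> l -> g h @[h --> x0^'+] --> l.
Proof.
move=> x0e fg; apply: cvg_trans; apply: near_eq_cvg; near=> h.
apply: fg; apply/andP.
by split; near: h; [exact: nbhs_right_gt|exact: nbhs_right_lt].
Unshelve. all: by end_near. Qed.

Lemma cvg_at_right0_exprn (R : realType) n :
  (0 < n)%N -> h ^+ n @[h --> 0^'+] --> (0 : R).
Proof.
move=> n_gt0; have := cvg_at_right_filter (@exprn_continuous R n 0).
by rewrite expr0n gtn_eqF.
Qed.

(** The quotient factors as [E / h ^+ nu] times [(expR E - 1) / h ^+ nu] times [(expR E + 1)^-1],
    with limits [a], [a] and [1 / 2]. *)
Lemma cvg_half_tanh (R : realType) (nu : nat) (E : R -> R) (a : R) :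
  (0 < nu)%N -> E h / h ^+ nu @[h --> 0^'+] --> a ->
  E h * half_tanh (E h) / h ^+ (2 * nu) @[h --> 0^'+]
    --> a ^+ 2 / 2.
Proof.
move=> nu_gt0 Ea.
have hnu := cvg_at_right0_exprn R _ nu_gt0.
have E0 : E h @[h --> 0^'+] --> 0.
  have /(_ _) := cvgM Ea hnu; rewrite mulr0.
  apply: (eq_cvg_at_right _ _ _ _ 1) => //.
  by move=> h /andP[h_gt0 _]; rewrite /= divfK// expf_neq0// gt_eqF.
have Ek : (expR (E h) - 1) / h ^+ nu @[h --> 0^'+] --> a.
  (* Squeezed between 0 and [2 * E * (E / h ^+ nu)], which tends to [2 * (0 * a)]. *)
  have R0 : (expR (E h) - 1 - E h) / h ^+ nu @[h --> 0^'+] --> 0.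
    have : 2 * (E h * (E h / h ^+ nu)) @[h --> 0^'+] --> 0.
      suff : 2 * (E h * (E h / h ^+ nu)) @[h --> 0^'+] --> 2 * (0 * a).
        by rewrite mul0r mulr0.
      by apply: cvgMr; exact: cvgM.
    apply: squeeze_cvgr; last exact: cvg_cst.
    near=> h.
    have h_gt0 : 0 < h ^+ nu.
      by rewrite exprn_gt0//; near: h; exact: nbhs_right_gt.
    have /expR_second_order/andP[r0 r2] : E h <= 1 / 2.
      by near: h; apply: (cvgr_le _ E0); rewrite divr_gt0.
    apply/andP; split; first by rewrite /= divr_ge0// ltW.
    have -> : 2 * (E h * (E h / h ^+ nu)) = 2 * E h ^+ 2 / h ^+ nu.
      by rewrite expr2 !mulrA.
    by rewrite ler_pM2r ?invr_gt0.
  have /(_ _) := cvgD Ea R0; rewrite addr0.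
  apply: (eq_cvg_at_right _ _ _ _ 1) => //.
  by move=> h _; rewrite /= -mulrDl addrC subrK.
have L2 : (expR (E h) + 1)^-1 @[h --> 0^'+] --> (2^-1 : R).
  have -> : 2^-1 = (expR 0 + 1)^-1 :> R by rewrite expR0.
  exact: (cvg_comp _ _ E0 (@continuous_logistic R 0)).
have L1 : E h / h ^+ nu * ((expR (E h) - 1) / h ^+ nu) @[h --> 0^'+] --> a ^+ 2.
  by rewrite expr2; exact: cvgM.
have /(_ _) := cvgM L1 L2.
apply: (eq_cvg_at_right _ _ _ _ 1) => // h /andP[h_gt0 _].
have Y1 : 0 < expR (E h) + 1 by rewrite addr_gt0// expR_gt0.
rewrite /= /half_tanh mul2n -addnn exprD; field.
by rewrite !gt_eqF// exprn_gt0.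
Unshelve. all: by end_near. Qed.

(** * Integrals under a measure-preserving map that reverses the energy error *)

Section measure_preserving.
Context d (T : measurableType d) (R : realType).
Variables (mu : {measure set T -> \bar R}) (phi : T -> T).
Hypothesis mphi : measurable_fun setT phi.
Hypothesis mu_phi : forall A, measurable A -> mu (phi @^-1` A) = mu A.

Lemma Rintegral_odd0 (f : T -> R) :
  mu.-integrable setT (EFin \o f) -> (forall x, f (phi x) = - f x) ->
  \int[mu]_x f x = 0.
Proof.
move=> intf fN.
have fphi : EFin \o f \o phi = -%E \o (EFin \o f).
  by apply/funext => x /=; rewrite fN.
have : (\int[mu]_x (f x)%:E = \int[mu]_x (- (f x)%:E))%E.
  transitivity (\int[pushforward mu phi]_x (EFin \o f) x)%E.
    by apply/esym/eq_measure_integral => A mA _; exact: mu_phi.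
  rewrite integral_pushforward//.
  - by rewrite preimage_setT fphi.
  - exact: measurable_int intf.
  - by rewrite preimage_setT fphi; exact: integrableN.
rewrite integralN; last by apply: integrable_add_def.
(* [fine] sends infinite values to 0; a finite value satisfies [r = - r]. *)
rewrite /Rintegral; case: (integral _ _ _) => //= r [].
by lra.
Qed.

Variables (H E : T -> R).
Hypotheses (mH : measurable_fun setT H) (mE : measurable_fun setT E).
Hypothesis E_phi : forall x, E (phi x) = - E x.
Hypothesis H_phi : forall x, H (phi x) = H x + E x.
Hypothesis int_H : mu.-integrable setT (EFin \o (fun x => expR (- H x))).
Hypothesis int_E2 :
  mu.-integrable setT (EFin \o (fun x => E x ^+ 2 * expR (- H x))).

Lemma Rintegral_reversible : 
  mu.-integrable setT
    (EFin \o (fun x => E x * half_tanh (E x) * expR (- H x))) /\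
  \int[mu]_x (E x * expR (- H x)) =
    \int[mu]_x (E x * half_tanh (E x) * expR (- H x)).
Proof.
pose K x := E x * (2 / (expR (E x) + 1)) * expR (- H x).
have mw : measurable_fun setT (fun x => expR (- H x)).
  by apply: measurableT_comp => //; exact: measurable_funN.
have ml : measurable_fun setT (fun x => (expR (E x) + 1)^-1).
  apply: (@measurableT_comp _ _ _ _ _ _ (fun t : R => (expR t + 1)^-1)) => //.
  exact: (continuous_measurable_fun (@continuous_logistic R)).
have int1E : mu.-integrable setT
    (EFin \o (fun x => expR (- H x) + E x ^+ 2 * expR (- H x))).
  exact: integrableD int_H int_E2.
have intK : mu.-integrable setT (EFin \o K).
  (* The logistic factor [2 / (expR E + 1)] is at most 2, and [|E| <= 1 + E ^+ 2]. *)
  apply: (le_integrable_EFin _ _ _ _ _ (fun x =>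
      2 * (expR (- H x) + E x ^+ 2 * expR (- H x)))) => [|x|].
  - apply: measurable_funM => //; apply: measurable_funM => //.
    exact: measurable_funM.
  - have Y0 := expR_gt0 (E x); have w0 := expR_gt0 (- H x).
    have Y1 : 0 < expR (E x) + 1 by rewrite addr_gt0.
    have l2 : 2 / (expR (E x) + 1) <= 2 by rewrite ler_pdivrMr//; nra.
    rewrite /K normrM (gtr0_norm w0) -[X in _ <= 2 * (X + _)]mul1r -mulrDl mulrA.
    rewrite ler_pM2r// normrM mulrC ler_pM// ?normr_ge0//.
      by rewrite ger0_norm// divr_ge0// ltW.
    by rewrite -(real_normK (num_real (E x))); nra.
  - exact: (integrableZl measurableT 2 int1E).
have intG : mu.-integrable setT (EFin \o
    (fun x => E x * half_tanh (E x) * expR (- H x))).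
  apply: le_integrable_EFin int_E2 => [|x].
    apply: measurable_funM => //; apply: measurable_funM => //.
    exact: measurableT_comp (measurable_half_tanh R) mE.
  rewrite normrM (ger0_norm (expR_ge0 _)) ler_wpM2r ?expR_ge0// normrM.
  by rewrite -(real_normK (num_real (E x))) expr2 ler_wpM2l// normr_half_tanh.
have K0 : \int[mu]_x K x = 0.
  (* Under [phi] the weight gains a factor [expR (- E)], which turns [1 / (expR (- E) + 1)] back
     into [1 / (expR E + 1)]; only the sign of [E] changes. *)
  apply: Rintegral_odd0 => // x; rewrite /K E_phi H_phi opprD expRD expRN.
  have := expR_gt0 (E x); set Y := expR (E x) => Y0.
  have Y1 : 0 < Y + 1 by rewrite addr_gt0.
  field.
  by rewrite !gt_eqF// addrC.
split=> //; rewrite -[RHS]add0r -K0 -RintegralD//.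
(* Here [2 / (Y + 1) + (Y - 1) / (Y + 1) = 1] with [Y = expR (E x)]. *)
apply: eq_Rintegral => x _; rewrite /K /half_tanh.
have Y1 : 0 < expR (E x) + 1 by rewrite addr_gt0// expR_gt0.
field.
by rewrite gt_eqF.
Qed.
End measure_preserving.

(** * Asymptotics of the mean and variance of the energy error *)

Theorem theorem7p1 (R : realType) (d nu : nat) (h0 : R)
  (H : 'rV[R]_(d + d) -> R) (Psi : R -> 'rV[R]_(d + d) -> 'rV[R]_(d + d))
  (a : 'rV[R]_(d + d) -> R) (r : 'rV[R]_(d + d) -> R -> R)
  (D : 'rV[R]_(d + d) -> R) :
  (0 < nu)%N ->
  0 < h0 ->
  (* H continuous, even in p, normalized *)
  continuous H ->
  (forall x, H (flip x) = H x) ->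
  (\int[@lebesgue_rV R (d + d)]_x (expR (- H x))%:E = 1)%E ->
  (* Psi_h: continuous, Lebesgue-measure-preserving bijection, reversible
     w.r.t. S (i.e. S o Psi_h = Psi_h^{-1} o S, equivalently Psi_h o S o Psi_h = S) *)
  (forall h, 0 < h < h0 ->
     [/\ continuous (Psi h),
         bijective (Psi h),
         (forall A, measurable A ->
            @lebesgue_rV R (d + d) (Psi h @^-1` A) = @lebesgue_rV R (d + d) A)
       & (forall x, Psi h (flip (Psi h x)) = flip x)]) ->
  (* (i) *)
  (forall h x, 0 < h < h0 ->
     energy_error H Psi h x = h ^+ nu * a x + h ^+ nu * r x h) ->
  (forall x, r x h @[h --> 0^'+] --> 0) ->
  (* (ii) *)
  (forall x, 0 <= D x) ->
  measurable_fun setT D ->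
  (\int[@lebesgue_rV R (d + d)]_x (D x * expR (- H x))%:E < +oo)%E ->
  (forall h x, 0 < h < h0 ->
     energy_error H Psi h x ^+ 2 / h ^+ (2 * nu) <= D x) ->
  let Sigma := fine (\int[@lebesgue_rV R (d + d)]_x
                         (a x ^+ 2 * expR (- H x))%:E)%E in
  (fun h => mean_err H Psi h / h ^+ (2 * nu)) @ 0^'+ --> Sigma / 2 /\
  (fun h => var_err H Psi h / h ^+ (2 * nu)) @ 0^'+ --> Sigma.
Proof.
move=> nu_gt0 h0_gt0 cH Hflip int1 HPsi Ear r0 D0 mD intD ED Sigma.
have [mu muE] := lebesgue_rV_measure R (d + d).
rewrite /mean_err /var_err /second_moment_err /mean_err /Sigma.
rewrite muE in int1 HPsi intD *.
pose E h x := energy_error H Psi h x; pose w x := expR (- H x).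
have mH : measurable_fun setT H by exact: continuous_measurable_rV.
have w0 x : 0 <= w x by exact: expR_ge0.
have mw : measurable_fun setT w.
  by apply: measurableT_comp => //; exact: measurable_funN.
have int_w : mu.-integrable setT (EFin \o w).
  by apply: ge0_integrable_EFin => //; rewrite int1 ltry.
have int_Dw : mu.-integrable setT (EFin \o (fun x => D x * w x)).
  apply: ge0_integrable_EFin => //; first exact: measurable_funM.
  by move=> x; rewrite mulr_ge0.
have mE h : 0 < h < h0 -> measurable_fun setT (E h).
  move=> /HPsi[cPsi _ _ _]; apply: measurable_funB => //.
  exact: measurableT_comp (continuous_measurable_rV_rV _ _ _ _ cPsi).
have h2_gt0 h : 0 < h < h0 -> 0 < h ^+ (2 * nu).
  by case/andP=> h_gt0 _; rewrite exprn_gt0.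
have int_E2 h : 0 < h < h0 ->
    mu.-integrable setT (EFin \o (fun x => E h x ^+ 2 * w x)).
  move=> hh; apply: (le_integrable_EFin _ _ _ _ _
      (fun x => h ^+ (2 * nu) * (D x * w x))) => [|x|].
  - by apply: measurable_funM => //; apply: measurable_funX; exact: mE.
  - rewrite (ger0_norm (mulr_ge0 (sqr_ge0 _) (w0 _))) mulrA ler_wpM2r//.
    by rewrite -ler_pdivrMl ?h2_gt0// mulrC ED.
  - exact: (integrableZl measurableT _ int_Dw).
have revE h : 0 < h < h0 ->
    mu.-integrable setT
      (EFin \o (fun x => E h x * half_tanh (E h x) * w x)) /\
    \int[mu]_x (E h x * w x) = \int[mu]_x (E h x * half_tanh (E h x) * w x).
  move=> hh; have [cPsi _ vPsi rPsi] := HPsi _ hh.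
  have mPsi := continuous_measurable_rV_rV _ _ _ _ cPsi.
  apply: (Rintegral_reversible _ _ _ mu (@flip R d \o Psi h)) => //.
  - exact: measurableT_comp (measurable_flip R d) mPsi.
  - move=> A mA; rewrite comp_preimage vPsi.
      by have := lebesgue_rV_flip R d A mA; rewrite muE.
    by rewrite -[X in measurable X]setTI; exact: measurable_flip.
  - exact: mE.
  (* Reversibility gives [Psi h (phi x) = flip x], of energy [H x], while [phi x] has energy
     [H (Psi h x)]: the error changes sign. *)
  - by move=> x; rewrite /E /energy_error /= rPsi !Hflip opprB.
  - by move=> x; rewrite /E /energy_error /= Hflip addrC subrK.
  - exact: int_E2.
have Ea x : E h x / h ^+ nu @[h --> 0^'+] --> a x.
  have : a x + r x h @[h --> 0^'+] --> a x.
    rewrite -[X in _ --> X]addr0; apply: cvgD; first exact: cvg_cst.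
    exact: r0.
  apply: (eq_cvg_at_right _ _ _ _ _ _ h0_gt0) => h hh.
  rewrite /E Ear// -mulrDr mulrC mulKf// expf_neq0// gt_eqF//.
  by case/andP: hh.
have [int_a2 cvg2] : mu.-integrable setT (EFin \o (fun x => a x ^+ 2 * w x)) /\
    \int[mu]_x (E h x ^+ 2 / h ^+ (2 * nu) * w x) @[h --> 0^'+] -->
    \int[mu]_x (a x ^+ 2 * w x).
  apply: (dominated_at_right _ _ _ _ h0 _ _ (fun x => D x * w x)) => //.
  - move=> h hh; apply: measurable_funM => //; apply: measurable_funM => //.
    by apply: measurable_funX; exact: mE.
  - move=> x; apply: cvgM; last exact: cvg_cst.
    have : (E h x / h ^+ nu) * (E h x / h ^+ nu) @[h --> 0^'+] --> a x ^+ 2.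
      by rewrite expr2; exact: cvgM.
    apply: (eq_cvg_at_right _ _ _ _ _ _ h0_gt0) => h _.
    by rewrite mulrACA -invfM -exprD addnn mul2n.
  - move=> h x hh; have := h2_gt0 _ hh => h2.
    have E2_ge0 : 0 <= E h x ^+ 2 / h ^+ (2 * nu).
      by rewrite divr_ge0 ?sqr_ge0// ltW.
    by rewrite (ger0_norm (mulr_ge0 E2_ge0 (w0 _))) ler_wpM2r// ED.
(* The direct integrand [E * w] is only of order [h ^+ nu]; its tanh form is bounded by
   [E ^+ 2 * w], hence by [h ^+ (2 * nu) * D * w]. *)
have [_ cvg1] : mu.-integrable setT (EFin \o (fun x => a x ^+ 2 / 2 * w x)) /\
    \int[mu]_x (E h x * half_tanh (E h x) / h ^+ (2 * nu) * w x) @[h --> 0^'+]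
      --> \int[mu]_x (a x ^+ 2 / 2 * w x).
  apply: (dominated_at_right _ _ _ _ h0 _ _ (fun x => D x * w x)) => //.
  - move=> h hh; apply: measurable_funM => //; apply: measurable_funM => //.
    apply: measurable_funM; first exact: mE.
    exact: measurableT_comp (measurable_half_tanh R) (mE _ hh).
  - move=> x; apply: cvgM; last exact: cvg_cst.
    exact: cvg_half_tanh.
  - move=> h x hh; have := h2_gt0 _ hh => h2.
    rewrite normrM (ger0_norm (w0 _)) ler_wpM2r//.
    apply: le_trans (ED h x hh).
    rewrite normrM normfV (gtr0_norm h2) ler_pM2r ?invr_gt0// normrM.
    by rewrite -(real_normK (num_real (E h x))) expr2 ler_wpM2l// normr_half_tanh.
have {}cvg1 : \int[mu]_x (E h x * w x) / h ^+ (2 * nu) @[h --> 0^'+] -->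
    \int[mu]_x (a x ^+ 2 * w x) / 2.
  rewrite (_ : \int[mu]_x (a x ^+ 2 * w x) / 2 = \int[mu]_x (a x ^+ 2 / 2 * w x)).
    move: cvg1; apply: (eq_cvg_at_right _ _ _ _ _ _ h0_gt0) => h hh.
    have [intE ->] := revE _ hh; rewrite mulrC -RintegralZl//.
    by apply: eq_Rintegral => x _; rewrite mulrA (mulrC (h ^+ _)^-1).
  rewrite mulrC -RintegralZl//.
  by apply: eq_Rintegral => x _; rewrite mulrA (mulrC 2^-1).
have {}cvg2 : \int[mu]_x (E h x ^+ 2 * w x) / h ^+ (2 * nu) @[h --> 0^'+] -->
    \int[mu]_x (a x ^+ 2 * w x).
  move: cvg2; apply: (eq_cvg_at_right _ _ _ _ _ _ h0_gt0) => h hh.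
  have intE := int_E2 _ hh; rewrite mulrC -RintegralZl//.
  by apply: eq_Rintegral => x _; rewrite mulrA (mulrC (h ^+ _)^-1).
split; first exact: cvg1.
have hnu : h ^+ (2 * nu) @[h --> 0^'+] --> (0 : R).
  by apply: cvg_at_right0_exprn; rewrite muln_gt0.
set S := \int[mu]_x (a x ^+ 2 * w x) in cvg1 cvg2.
(* The squared mean over [h ^+ (2 * nu)] is the square of the convergent scaled mean times
   [h ^+ (2 * nu)], so it vanishes in the limit. *)
have : \int[mu]_x (E h x ^+ 2 * w x) / h ^+ (2 * nu) -
    (\int[mu]_x (E h x * w x) / h ^+ (2 * nu)) ^+ 2 * h ^+ (2 * nu)
    @[h --> 0^'+] --> S - (S / 2) ^+ 2 * 0.
  apply: cvgB => //; apply: cvgM => //; rewrite expr2.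
  exact: cvgM.
rewrite mulr0 subr0.
apply: (eq_cvg_at_right _ _ _ _ _ _ h0_gt0) => h hh.
have := h2_gt0 _ hh => h2.
by rewrite /= mulrBl expr_div_n (expr2 (h ^+ _)) invfM !mulrA mulfVK// gt_eqF.
Qed.
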